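(* Let $X$ be the $2$-cross piecewise-smooth vector field on $\mathbb{R}^3$ generated by the constant vector fields $X_s=(a_s,b_s,1)$ with $a_s,b_s\in\mathbb{R}$, $s=(s_1,s_2)\in\{-,+\}^2$. Let $\varphi$ be a transition function, let $X_{\varepsilon,\eta}$ be the double regularization of $X$ induced by $\varphi$, and consider the associated $x_1x_2$-system $$x_1'=\frac{1}{4\varepsilon}\sum_{s}(1+s_1\varphi(x_1))(1+s_2\varphi(x_2))a_s,\qquad x_2'=\frac{1}{4\eta}\sum_{s}(1+s_1\varphi(x_1))(1+s_2\varphi(x_2))b_s,$$ obtained from the first two components of $X_{\varepsilon,\eta}$ by the blow-up $x_1\to\varepsilon x_1$, $x_2\to\eta x_2$. Assume that the equilibrium points of the $x_1x_2$-system are located in $(-1,1)^2$. (i) If the $x_1x_2$-system has two equilibria, then every point of $\Sigma_{00}$ is a sliding point of $X$ (for any $\varepsilon,\eta$, i.e. with no restriction on how $(\varepsilon,\eta)\to(0,0)$). (ii) If the $x_1x_2$-system has only one equilibrium, and this equilibrium is asymptotically stable or asymptotically unstable when $\varepsilon,\eta\to0$ (i.e. for all sufficiently small $\varepsilon,\eta>0$), then every point of $\Sigma_{00}$ is a sliding point of $X$.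
   Context: Coordinates on $\mathbb{R}^3$ are $\mathbf{x}=(x_1,x_2,x_3)$. The $2$-cross piecewise-smooth vector field generated by smooth vector fields $X_s$, $s=(s_1,s_2)\in\{-,+\}^2$, is $$X=\frac14\sum_{s}(1+s_1\operatorname{sgn}(x_1))(1+s_2\operatorname{sgn}(x_2))X_s,$$ i.e. $X=X_s$ on the open region where $\operatorname{sgn}(x_1)=s_1$, $\operatorname{sgn}(x_2)=s_2$. The codimension 2 switching set is $\Sigma_{00}=\{x_1=x_2=0\}$. A transition function is a $C^\infty$ function $\varphi:\mathbb{R}\to\mathbb{R}$ with $\varphi(t)=-1$ for $t\le -1$, $\varphi(t)=1$ for $t\ge 1$ and $\varphi'(t)>0$ for $-1<t<1$. The double regularization of $X$ is, for $\varepsilon,\eta>0$, $$X_{\varepsilon,\eta}(\mathbf{x})=\frac14\sum_{s\in\{-,+\}^2}\Big(1+s_1\varphi\big(\tfrac{x_1}{\varepsilon}\big)\Big)\Big(1+s_2\varphi\big(\tfrac{x_2}{\eta}\big)\Big)X_s(\mathbf{x}).$$ Sliding point (depending on $X_{\varepsilon,\eta}$): $p\in\Sigma_{00}$ is a sliding point of $X$ if there exist an open neighborhood $U\subset\mathbb{R}^3$ of $p$ and a family of smooth manifolds $S_{\varepsilon,\eta}\subset U$, defined for all $\varepsilon,\eta>0$, such that (1) each $S_{\varepsilon,\eta}$ is invariant by the restriction of $X_{\varepsilon,\eta}$ to $U$; (2) $S_{\varepsilon,\eta}$ converges to $\Sigma_{00}$ on compact subsets of $U$ in the Hausdorff sense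 as $(\varepsilon,\eta)\to(0,0)$: for each compact $K\subset U$, $\sup_{x\in S_{\varepsilon,\eta}\cap K}\operatorname{dist}(x,\Sigma_{00})\to0$ and $\sup_{x\in\Sigma_{00}\cap K}\operatorname{dist}(x,S_{\varepsilon,\eta})\to0$. An equilibrium is asymptotically unstable if it is asymptotically stable for the time-reversed flow. *)

(* Defs.v *)
From HB Require Import structures.
From mathcomp Require Import all_boot all_order all_algebra.
From mathcomp Require Import all_classical all_reals all_analysis.

Set Implicit Arguments.
Unset Strict Implicit.
Unset Printing Implicit Defensive.

Import Order.TTheory GRing.Theory Num.Theory.
Import numFieldNormedType.Exports.

Local Open Scope classical_set_scope.
Local Open Scope ring_scope.

(** * Smooth maps and submanifolds of R^3 *)

(* The points of [V] are interior in all uses, so the values of ['D_e f] on [V]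
   depend only on [f] restricted to [V]. *)
Fixpoint Ck_on (R : realType) (k : nat) (V : set 'rV[R]_3)
    (f : 'rV[R]_3 -> R) : Prop :=
  (forall x, V x -> {for x, continuous f}) /\
  (if k is k'.+1 then
     forall i : 'I_3,
       (forall x, V x -> derivable f x (delta_mx 0 i)) /\
       Ck_on k' V (fun x => 'D_(delta_mx 0 i) f x)
   else True).

Definition smooth_on (R : realType) (V : set 'rV[R]_3)
    (F : 'rV[R]_3 -> 'rV[R]_3) : Prop :=
  forall (k : nat) (i : 'I_3), Ck_on k V (fun x => F x 0 i).

(* Embedded C^oo submanifold without boundary, given by slice charts: [Phi] is a
   diffeomorphism from the neighbourhood [V] of [p] onto the open set [W],
   with inverse [Psi], straightening [S] to a [d]-dimensional coordinate plane.
   [S] need not be closed. *)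
Definition smooth_submanifold (R : realType) (S : set 'rV[R]_3) : Prop :=
  exists2 d : nat, (d <= 3)%N &
  forall p, S p ->
  exists (V W : set 'rV[R]_3) (Phi Psi : 'rV[R]_3 -> 'rV[R]_3),
    [/\ open V, V p & open W] /\
    [/\ smooth_on V Phi, smooth_on W Psi,
        (forall x, V x -> W (Phi x) /\ Psi (Phi x) = x) &
        (forall y, W y -> V (Psi y) /\ Phi (Psi y) = y)] /\
    (forall x, V x ->
       (S x <-> forall i : 'I_3, (d <= i)%N -> Phi x 0 i = 0)).

(** * Integral curves, invariance, stability *)

Definition integral_curve (R : realType) (n : nat)
    (F : 'rV[R]_n.+1 -> 'rV[R]_n.+1) (I : set R) (g : R -> 'rV[R]_n.+1) : Prop :=
  [/\ open I, is_interval I & forall t, I t -> is_derive t 1 g (F (g t))].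

(* Every orbit of [F] restricted to [U] that meets [S] is contained in [S]. *)
Definition invariant_in (R : realType) (n : nat)
    (F : 'rV[R]_n.+1 -> 'rV[R]_n.+1) (U S : set 'rV[R]_n.+1) : Prop :=
  forall (I : set R) (g : R -> 'rV[R]_n.+1),
    integral_curve F I g -> (forall t, I t -> U (g t)) ->
    forall t0, I t0 -> S (g t0) -> forall t, I t -> S (g t).

Definition equilibria (R : realType) (n : nat)
    (F : 'rV[R]_n.+1 -> 'rV[R]_n.+1) : set 'rV[R]_n.+1 :=
  [set x | F x = 0].

Definition lyapunov_stable (R : realType) (n : nat)
    (F : 'rV[R]_n.+1 -> 'rV[R]_n.+1) (p : 'rV[R]_n.+1) : Prop :=
  forall A : set 'rV[R]_n.+1, nbhs p A ->
  exists2 B : set 'rV[R]_n.+1, nbhs p B &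
    forall (I : set R) (g : R -> 'rV[R]_n.+1),
      integral_curve F I g -> I 0 -> B (g 0) ->
      forall t : R, I t -> 0 <= t -> A (g t).

Definition attractive (R : realType) (n : nat)
    (F : 'rV[R]_n.+1 -> 'rV[R]_n.+1) (p : 'rV[R]_n.+1) : Prop :=
  exists2 B : set 'rV[R]_n.+1, nbhs p B &
    forall (I : set R) (g : R -> 'rV[R]_n.+1),
      integral_curve F I g -> (forall t : R, 0 <= t -> I t) -> B (g 0) ->
      g t @[t --> +oo] --> p.

Definition asymptotically_stable (R : realType) (n : nat)
    (F : 'rV[R]_n.+1 -> 'rV[R]_n.+1) (p : 'rV[R]_n.+1) : Prop :=
  [/\ equilibria F p, lyapunov_stable F p & attractive F p].

Definition asymptotically_unstable (R : realType) (n : nat)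
    (F : 'rV[R]_n.+1 -> 'rV[R]_n.+1) (p : 'rV[R]_n.+1) : Prop :=
  asymptotically_stable (fun x => - F x) p.

(** * Hausdorff-type distances (Euclidean) *)

Definition euclid_dist (R : realType) (x y : 'rV[R]_3) : R :=
  Num.sqrt (\sum_(i < 3) (x 0 i - y 0 i) ^+ 2).

(* Equal to [+oo] if [B] is empty. *)
Definition dist_to (R : realType) (x : 'rV[R]_3) (B : set 'rV[R]_3) : \bar R :=
  ereal_inf [set (euclid_dist x y)%:E | y in B].

(* Supremum over [A] of the distance to [B], taken in [0, +oo], so that it is [0]
   and not [-oo] when [A] is empty. *)
Definition excess (R : realType) (A B : set 'rV[R]_3) : \bar R :=
  ereal_sup ([set 0%E] `|` [set dist_to x B | x in A]).

(** * 2-cross fields and their double regularization *)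

(* The coordinates x_1, x_2, x_3 have indices 0, 1, 2. *)
Definition Sigma00 (R : realType) : set 'rV[R]_3 :=
  [set x | x 0 0 = 0 /\ x 0 1 = 0].
Arguments Sigma00 : clear implicits.

(* The multi-index s in {-,+}^2 is a pair of booleans, [true] standing for +. *)
Definition signb (R : realType) (s : bool) : R := if s then 1 else -1.

Definition cross_mix (R : realType)
    (Xs : bool * bool -> 'rV[R]_3 -> 'rV[R]_3) (u v : R) (x : 'rV[R]_3) :
    'rV[R]_3 :=
  4^-1 *: \sum_(s : bool * bool)
            ((1 + signb R s.1 * u) * (1 + signb R s.2 * v)) *: Xs s x.

Definition cross_field (R : realType)
    (Xs : bool * bool -> 'rV[R]_3 -> 'rV[R]_3) (x : 'rV[R]_3) : 'rV[R]_3 :=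
  cross_mix Xs (Num.sg (x 0 0)) (Num.sg (x 0 1)) x.

Definition transition_function (R : realType) (phi : R -> R) : Prop :=
  [/\ (forall (n : nat) (t : R), derivable (derive1n n phi) t 1),
      (forall t : R, t <= -1 -> phi t = -1),
      (forall t : R, 1 <= t -> phi t = 1) &
      (forall t : R, -1 < t -> t < 1 -> 0 < derive1 phi t)].

Definition double_regularization (R : realType) (phi : R -> R)
    (Xs : bool * bool -> 'rV[R]_3 -> 'rV[R]_3) (eps eta : R) (x : 'rV[R]_3) :
    'rV[R]_3 :=
  cross_mix Xs (phi (x 0 0 / eps)) (phi (x 0 1 / eta)) x.

(* [p] is a sliding point of [cross_field Xs], with respect to the double
   regularization induced by [phi]. The parameters tend to (0, 0) through
   positive values, independently of each other. *)
Definition sliding_point (R : realType) (phi : R -> R)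
    (Xs : bool * bool -> 'rV[R]_3 -> 'rV[R]_3) (p : 'rV[R]_3) : Prop :=
  Sigma00 R p /\
  exists (U : set 'rV[R]_3) (S : R -> R -> set 'rV[R]_3),
    [/\ open U, U p,
        (forall eps eta : R, 0 < eps -> 0 < eta ->
           [/\ S eps eta `<=` U, smooth_submanifold (S eps eta) &
               invariant_in (double_regularization phi Xs eps eta)
                 U (S eps eta)]) &
        (forall K : set 'rV[R]_3, compact K -> K `<=` U ->
           (excess (S e.1 e.2 `&` K) (Sigma00 R)
              @[e --> filter_prod (0 : R)^'+ (0 : R)^'+] --> 0%E) /\
           (excess (Sigma00 R `&` K) (S e.1 e.2)
              @[e --> filter_prod (0 : R)^'+ (0 : R)^'+] --> 0%E))].

(** * Fields generated by X_s = (a_s, b_s, 1) *)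

Definition constant_fields (R : realType) (a b : bool * bool -> R)
    (s : bool * bool) (x : 'rV[R]_3) : 'rV[R]_3 :=
  \row_(i < 3) [:: a s; b s; 1]`_i.

Definition x1x2_system (R : realType) (phi : R -> R) (a b : bool * bool -> R)
    (eps eta : R) (x : 'rV[R]_2) : 'rV[R]_2 :=
  let w (s : bool * bool) :=
    (1 + signb R s.1 * phi (x 0 0)) * (1 + signb R s.2 * phi (x 0 1)) in
  \row_(i < 2) [:: (4 * eps)^-1 * \sum_(s : bool * bool) w s * a s;
                   (4 * eta)^-1 * \sum_(s : bool * bool) w s * b s]`_i.

(* The blow-up x_1 -> eps x_1, x_2 -> eta x_2: along x_1 = eps y_1,
   x_2 = eta y_2, the first two components of the regularization are
   eps y_1' and eta y_2'. *)
Lemma x1x2_system_blow_up (R : realType) (phi : R -> R)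
    (a b : bool * bool -> R) (eps eta : R) (x : 'rV[R]_3) (y : 'rV[R]_2) :
  0 < eps -> 0 < eta -> x 0 0 = eps * y 0 0 -> x 0 1 = eta * y 0 1 ->
  let X := double_regularization phi (constant_fields a b) eps eta x in
  X 0 0 = eps * x1x2_system phi a b eps eta y 0 0 /\
  X 0 1 = eta * x1x2_system phi a b eps eta y 0 1.
Proof.
move=> e0 h0 x0 x1 /=.
have e1 : eps != 0 by rewrite gt_eqF.
have h1 : eta != 0 by rewrite gt_eqF.
rewrite /double_regularization /cross_mix x0 x1.
rewrite [eps * _ / _]mulrAC [eta * _ / _]mulrAC !divff // !mul1r.
rewrite !mxE !summxE /= !invfM; split.
- rewrite mulrA [eps * _]mulrC mulfVK //; congr (_ * _).
  by apply: eq_bigr => s _; rewrite !mxE.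
- rewrite mulrA [eta * _]mulrC mulfVK //; congr (_ * _).
  by apply: eq_bigr => s _; rewrite !mxE.
Qed.

(* Main.v *)
Require Import Defs.
From HB Require Import structures.
From mathcomp Require Import all_boot all_order all_algebra.
From mathcomp Require Import all_classical all_reals all_analysis.
From mathcomp Require Import ring lra.

Set Implicit Arguments.
Unset Strict Implicit.
Unset Printing Implicit Defensive.

Import Order.TTheory GRing.Theory Num.Theory.
Import numFieldNormedType.Exports.

Local Open Scope classical_set_scope.
Local Open Scope ring_scope.

(** An equilibrium p of the x_1x_2-system does not depend on (eps, eta): it is a
    common zero of the bilinear forms obtained by averaging the a_s and the b_s,
    evaluated at (phi x_1, phi x_2). Undoing the blow-up, the vertical lines
    x_1 = eps p_1, x_2 = eta p_2 serve as S_{eps,eta}, with U = R^3. They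
    converge to Sigma_00, and they are invariant because phi is Lipschitz: an
    orbit meeting the line stays in it by uniqueness of solutions. *)

(** * Uniqueness through linear growth estimates *)

Lemma eq0_of_linear_growth (R : realType) (I : set R) (u du : R -> R) (C : R) :
  is_interval I -> (forall t, I t -> is_derive t 1 u (du t)) ->
  (forall t, I t -> 0 <= u t) -> (forall t, I t -> `|du t| <= C * u t) ->
  forall t0 t, I t0 -> u t0 = 0 -> I t -> u t = 0.
Proof.
move=> itvI uE u_ge0 duC t0 t It0 ut0 It.
(* The mean value theorem for [u * exp (k t)], with [k = C] to the left of [t0]
   and [k = - C] to its right. *)
have mvt (k s s' : R) : s < s' -> I s -> I s' -> exists2 c, I c &
    u s' * expR (k * s') - u s * expR (k * s)
      = (expR (k * c) * (du c + k * u c)) * (s' - s).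
  move=> ss' Is Is'.
  have sub c : s <= c <= s' -> I c by exact: itvI.
  have hE c : I c -> is_derive c 1 (fun r => u r * expR (k * r))
      (expR (k * c) * (du c + k * u c)).
    move=> Ic; have uc := uE _ Ic.
    have kc : is_derive c 1 (fun r : R => k * r) k.
      by have := is_deriveZ k (is_derive_id c 1); rewrite /GRing.scale /= mulr1.
    have ec := @is_derive1_comp _ _ _ _ _ _ (is_derive_expR (k * c)) kc.
    by apply: is_derive_eq (is_deriveM uc ec) _; rewrite /GRing.scale /=; ring.
  have hc : {within `[s, s'], continuous (fun r => u r * expR (k * r))}.
    apply: (@derivable_within_continuous _ _ _ `[s, s']) => c.
    by rewrite in_itv/= => cs; have [] := hE _ (sub _ cs).
  have hd c : c \in `]s, s'[ -> is_derive c 1 (fun r => u r * expR (k * r))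
      (expR (k * c) * (du c + k * u c)).
    by rewrite in_itv/= => /andP[sc cs']; apply/hE/sub; rewrite !ltW.
  have [c cs ->] := MVT ss' hd hc; exists c => //.
  by move: cs; rewrite in_itv/= => /andP[sc cs']; apply: sub; rewrite !ltW.
(* Only [u t <= 0] remains. To the left of [t0], [du + C * u >= 0] makes the product nondecreasing
   up to its value 0 at [t0]; to the right, [du - C * u <= 0] makes it nonincreasing from 0. *)
apply/eqP; rewrite eq_le u_ge0// andbT.
have [tt0|tt0|->] := ltgtP t t0; last by rewrite ut0.
- have [c Ic] := mvt C _ _ tt0 It It0; rewrite ut0 mul0r sub0r => eqc.
  rewrite -(pmulr_lle0 _ (expR_gt0 (C * t))) mulrC -oppr_ge0 mulrC eqc.
  rewrite mulr_ge0 ?subr_ge0 ?(ltW tt0)// mulr_ge0 ?expR_ge0//.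
  by move: (duC _ Ic); rewrite ler_norml => /andP[]; lra.
- have [c Ic] := mvt (- C) _ _ tt0 It0 It; rewrite ut0 mul0r subr0 => eqc.
  rewrite -(pmulr_lle0 _ (expR_gt0 (- C * t))) mulrC -oppr_ge0 mulrC eqc.
  rewrite -mulNr mulr_ge0 ?subr_ge0 ?(ltW tt0)// -mulrN mulr_ge0 ?expR_ge0//.
  by move: (duC _ Ic); rewrite ler_norml => /andP[]; lra.
Qed.

(** The squared norm [f ^+ 2 + g ^+ 2] reduces this to the scalar case: unlike [|f| + |g|] it is
    differentiable at the zeros, and its derivative is bounded by a multiple of itself. *)
Lemma planar_eq0_of_linear_growth (R : realType) (I : set R)
    (f g df dg : R -> R) (K : R) :
  is_interval I ->
  (forall t, I t -> is_derive t 1 f (df t)) ->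
  (forall t, I t -> is_derive t 1 g (dg t)) ->
  (forall t, I t -> `|df t| <= K * (`|f t| + `|g t|)) ->
  (forall t, I t -> `|dg t| <= K * (`|f t| + `|g t|)) ->
  forall t0 t, I t0 -> f t0 = 0 -> g t0 = 0 -> I t -> f t = 0 /\ g t = 0.
Proof.
move=> itvI fE gE dfK dgK t0 t It0 f0 g0 It.
suff /eqP : f t ^+ 2 + g t ^+ 2 = 0.
  by rewrite paddr_eq0 ?sqr_ge0// !sqrf_eq0 => /andP[/eqP-> /eqP->].
(* In the factor 4, one 2 comes from differentiating the squares and the other from (|f| + |g|)^2 <=
   2 (f^2 + g^2). The sign of [K] is not assumed, hence [|K|]. *)
apply: (@eq0_of_linear_growth _ I (fun s => f s ^+ 2 + g s ^+ 2)
  (fun s => 2 * (f s * df s + g s * dg s)) (`|K| * 4) itvI _ _ _ t0 t) => //.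
- move=> s Is; have fs := fE _ Is; have gs := gE _ Is.
  apply: is_derive_eq (is_deriveD (is_deriveX 2 fs) (is_deriveX 2 gs)) _.
  by rewrite /GRing.scale /= !expr1; ring.
- by move=> s _; rewrite addr_ge0 ?sqr_ge0.
- move=> s Is; set n := `|f s| + `|g s|.
  have nK : K * n <= `|K| * n by rewrite ler_wpM2r ?ler_norm ?addr_ge0.
  have le2 : `|f s * df s + g s * dg s| <= `|K| * n ^+ 2.
    rewrite (le_trans (ler_normD _ _))// !normrM.
    rewrite (_ : `|K| * n ^+ 2 = `|f s| * (`|K| * n) + `|g s| * (`|K| * n));
      last by rewrite /n; ring.
    by rewrite lerD// ler_wpM2l// (le_trans _ nK)// ?dfK ?dgK.
  rewrite normrM ger0_norm//.
  have : n ^+ 2 <= 2 * (f s ^+ 2 + g s ^+ 2).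
    rewrite -[f s ^+ 2]real_normK ?num_real// -[g s ^+ 2]real_normK ?num_real//.
    by rewrite /n; have := sqr_ge0 (`|f s| - `|g s|); lra.
  move=> /(ler_wpM2l (normr_ge0 K)); lra.
- by rewrite f0 g0 expr0n addr0.
Qed.

(** * Estimates on the transition function and on the averaged components *)

(** The derivative is continuous, so its absolute value has a maximum [L] on [-1, 1]. The mean value
    theorem gives the estimate there, and clamping carries it to the whole line. *)
Lemma transition_lipschitz (R : realType) (phi : R -> R) :
  transition_function phi ->
  exists2 L, 0 <= L & forall x y, `|phi x - phi y| <= L * `|x - y|.
Proof.
move=> [phi_smooth phiN1 phi1 _].
have dphi t : derivable phi t 1 by exact: (phi_smooth 0%N t).
have cphi : {within `[-1, 1], continuous (fun t => `|derive1 phi t|)}.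
  apply/continuous_subspaceT => t; apply: continuous_comp; last first.
    exact: norm_continuous.
  by apply/differentiable_continuous/derivable1_diffP; exact: (phi_smooth 1%N t).
have N11 : -1 <= 1 :> R by lra.
have [c _ maxc] := EVT_max N11 cphi.
set L := `|derive1 phi c|.
have lip x y : -1 <= x -> y <= 1 -> x <= y -> `|phi x - phi y| <= L * `|x - y|.
  move=> x1 y1; rewrite le_eqVlt => /predU1P[->|xy].
    by rewrite !subrr !normr0 mulr0.
  have hd t : t \in `]x, y[ -> is_derive t 1 phi (derive1 phi t).
    by move=> _; rewrite derive1E; exact/derivableP.
  have hc : {within `[x, y], continuous phi}.
    by apply: (@derivable_within_continuous _ _ _ `[x, y]) => t _; exact: dphi.
  have [d dxy eqd] := MVT xy hd hc.
  rewrite distrC eqd normrM (distrC x) ler_wpM2r//.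
  by apply: maxc; move: dxy; rewrite !in_itv/=; lra.
pose clamp x : R := Num.max (-1) (Num.min 1 x).
have phi_clamp x : phi (clamp x) = phi x.
  rewrite /clamp minEle maxElt.
  case: (leP 1 x) => x1; first by rewrite ifT ?phi1//; lra.
  by case: ltP => // xN; rewrite !phiN1.
have clamp_ge x : -1 <= clamp x by rewrite /clamp le_max lexx.
have clamp_le x : clamp x <= 1 by rewrite /clamp ge_max ge_min lexx andbT; lra.
have clamp_lip x y : x <= y -> clamp x <= clamp y /\ clamp y - clamp x <= y - x.
  rewrite /clamp !minEle !maxElt; case: (leP 1 x) => ?; case: (leP 1 y) => ?;
    by do 2 ?[case: (ltP (-1) _) => ?] => ?; lra.
have L_ge0 : 0 <= L by exact: normr_ge0.
exists L => // x y; rewrite -(phi_clamp x) -(phi_clamp y).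
wlog xy : x y / x <= y.
  move=> H; have [/H//|/ltW/H] := leP x y.
  by rewrite distrC (distrC y).
have [le1 le2] := clamp_lip _ _ xy.
rewrite (le_trans (lip _ _ _ _ le1))// ler_wpM2l//.
by rewrite distrC ger0_norm ?subr_ge0// distrC ger0_norm ?subr_ge0.
Qed.

(** On [-1, 1] the positive derivative makes [phi] monotone between its end values -1 and 1. The
    bound is what the Lipschitz estimate for [blend] requires, a bilinear form being Lipschitz only
    on bounded sets. *)
Lemma transition_bounded (R : realType) (phi : R -> R) :
  transition_function phi -> forall x, `|phi x| <= 1.
Proof.
move=> [phi_smooth phiN1 phi1 dphi_gt0] x.
have [x1|x1] := leP x (-1); first by rewrite phiN1// normrN normr1.
have [x2|x2] := leP 1 x; first by rewrite phi1// normr1.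
have phi_homo s t : s < t -> -1 <= s -> t <= 1 -> phi s <= phi t.
  move=> st s1 t1; rewrite -subr_ge0.
  have hd r : r \in `]s, t[ -> is_derive r 1 phi (derive1 phi r).
    by move=> _; rewrite derive1E; exact/derivableP/(phi_smooth 0%N).
  have hc : {within `[s, t], continuous phi}.
    apply: (@derivable_within_continuous _ _ _ `[s, t]) => r _.
    exact: (phi_smooth 0%N).
  have [d + ->] := MVT st hd hc; rewrite in_itv/= => dst.
  by rewrite mulr_ge0 ?subr_ge0 ?(ltW st)// ltW// dphi_gt0; lra.
by rewrite ler_norml -(phiN1 (-1))// -{2}(phi1 1)// !phi_homo// ltW.
Qed.

Lemma is_derive_coord (R : realType) (V : normedModType R) (n : nat)
    (g : V -> 'rV[R]_n) (dg : 'rV[R]_n) (t v : V) (i : 'I_n) :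
  is_derive t v g dg -> is_derive t v (fun s => g s 0 i) (dg 0 i).
Proof.
case=> dgt <-; apply: DeriveDef; first exact: (derivable_mxP _ _ _).1 dgt _ _.
by rewrite derive_mx// mxE.
Qed.

(** Four times the bilinear interpolation of the corner values [c s] on the square [-1, 1]^2. The
    regularization and the x_1x_2-system share this sum and differ only in its prefactor. *)
Definition blend (R : realType) (c : bool * bool -> R) (u v : R) : R :=
  \sum_(s : bool * bool) (1 + signb R s.1 * u) * (1 + signb R s.2 * v) * c s.

Lemma blend_lipschitz (R : realType) (c : bool * bool -> R) :
  exists2 K, 0 <= K & forall u v u0 v0, `|u| <= 1 -> `|v0| <= 1 ->
    `|blend c u v - blend c u0 v0| <= K * (`|u - u0| + `|v - v0|).
Proof.
exists (\sum_(s : bool * bool) 2 * `|c s|).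
  by apply: sumr_ge0 => s _; rewrite mulr_ge0.
move=> u v u0 v0 u1 v1; rewrite /blend -sumrB mulr_suml.
rewrite (le_trans (ler_norm_sum _ _ _))//; apply: ler_sum => s _.
have sN (e : bool) (w : R) : `|signb R e * w| = `|w|.
  by rewrite normrM; case: e; rewrite /signb ?normrN normr1 mul1r.
have le2 (e : bool) (w : R) : `|w| <= 1 -> `|1 + signb R e * w| <= 2.
  by move=> w1; rewrite (le_trans (ler_normD _ _))// normr1 sN; lra.
(* One variable moves at a time, from (u0, v0) to (u, v0) and then to (u, v). The factors left over
   involve only [v0] and [u], which is why these two are the ones assumed bounded. *)
rewrite (_ : _ - _ = c s * (signb R s.1 * (u - u0) * (1 + signb R s.2 * v0)
    + signb R s.2 * (v - v0) * (1 + signb R s.1 * u))); last by ring.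
rewrite normrM [2 * _]mulrC -[leRHS]mulrA ler_wpM2l//.
rewrite (le_trans (ler_normD _ _))// !(normrM (_ * _)) !sN.
rewrite [leRHS]mulrC [leRHS]mulrDl.
by rewrite lerD// ler_wpM2l// le2.
Qed.

Lemma double_regularization_constantE (R : realType) (phi : R -> R)
    (a b : bool * bool -> R) (eps eta : R) (x : 'rV[R]_3) :
  let X := double_regularization phi (constant_fields a b) eps eta x in
  let u := phi (x 0 0 / eps) in let v := phi (x 0 1 / eta) in
  X 0 0 = 4^-1 * blend a u v /\ X 0 1 = 4^-1 * blend b u v.
Proof.
rewrite /= /double_regularization /cross_mix !mxE !summxE /blend; split;
  by congr (_ * _); apply: eq_bigr => s _; rewrite !mxE.
Qed.

(** * Invariance of the vertical lines *)

Definition vertical_line (R : realType) (c d : R) : set 'rV[R]_3 :=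
  [set x | x 0 0 = c /\ x 0 1 = d].

Lemma vertical_line_invariant (R : realType) (phi : R -> R)
    (a b : bool * bool -> R) (y0 y1 eps eta : R) (U : set 'rV[R]_3) :
  transition_function phi ->
  blend a (phi y0) (phi y1) = 0 -> blend b (phi y0) (phi y1) = 0 ->
  0 < eps -> 0 < eta ->
  invariant_in (double_regularization phi (constant_fields a b) eps eta) U
    (vertical_line (eps * y0) (eta * y1)).
Proof.
move=> hphi a0 b0 eps0 eta0 I g [_ itvI gE] _ t0 It0 [g0 g1] t It.
have [L L_ge0 phiL] := transition_lipschitz hphi.
have phi1 := transition_bounded hphi.
have [epsN0 etaN0] : eps != 0 /\ eta != 0 by rewrite !gt_eqF.
pose F s := double_regularization phi (constant_fields a b) eps eta (g s).
(* Blown-up coordinates of the orbit, centred at the common zero: the orbit is on the line exactly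
   when both vanish. *)
pose f s := g s 0 0 / eps - y0; pose h s := g s 0 1 / eta - y1.
(* Subtracting the zero value at (phi y0, phi y1) turns the Lipschitz estimates of [blend] and [phi]
   into a linear bound; the prefactor 1/4 is simply bounded by 1. *)
have bound c : blend c (phi y0) (phi y1) = 0 -> exists2 M, 0 <= M &
    forall s, `|4^-1 * blend c (phi (g s 0 0 / eps)) (phi (g s 0 1 / eta))|
      <= M * (`|f s| + `|h s|).
  move=> c0; have [K K_ge0 blendK] := blend_lipschitz c.
  exists (K * L) => [|s]; first exact: mulr_ge0.
  rewrite normrM ger0_norm ?invr_ge0//.
  apply: (@le_trans _ _ (1 * (K * (L * (`|f s| + `|h s|))))); last first.
    by rewrite mul1r mulrA.
  apply: ler_pM; rewrite ?invr_ge0//; first by rewrite invf_le1//; lra.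
  rewrite -[blend _ _ _]subr0 -c0 (le_trans (blendK _ _ _ _ _ _))//.
  by rewrite ler_wpM2l// mulrDr lerD ?phiL.
have [Ma Ma0 HMa] := bound a a0; have [Mb Mb0 HMb] := bound b b0.
have scale (i : 'I_3) (r k : R) s : I s ->
    is_derive s 1 (fun s => g s 0 i / r - k) (F s 0 i / r).
  move=> Is; have di := is_derive_coord i (gE _ Is).
  apply: is_derive_eq (is_deriveB (is_deriveM di (is_derive_cst r^-1 s 1))
    (is_derive_cst k s 1)) _.
  by rewrite /GRing.scale /= mulr0 add0r subr0 mulrC.
have n_ge0 s : 0 <= `|f s| + `|h s| by exact: addr_ge0.
have Ea s : F s 0 0 = _ := (double_regularization_constantE _ _ _ _ _ _).1.
have Eb s : F s 0 1 = _ := (double_regularization_constantE _ _ _ _ _ _).2.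
(* Rescaling divides the two velocities by [eps] and [eta]; the sum of the resulting constants
   serves for both components. *)
have [||||ft ht] := @planar_eq0_of_linear_growth _ I f h
  (fun s => F s 0 0 / eps) (fun s => F s 0 1 / eta)
  (Ma / eps + Mb / eta) itvI (fun s => scale 0 eps y0 s)
  (fun s => scale 1 eta y1 s) _ _ t0 t It0 _ _ It.
- move=> s _; rewrite Ea normrM [`|eps^-1|]ger0_norm ?invr_ge0 ?(ltW eps0)//.
  rewrite mulrDl -[leLHS]addr0 lerD//; last by rewrite !mulr_ge0// invr_ge0 ltW.
  by rewrite mulrAC ler_wpM2r ?invr_ge0 ?(ltW eps0).
- move=> s _; rewrite Eb normrM [`|eta^-1|]ger0_norm ?invr_ge0 ?(ltW eta0)//.
  rewrite mulrDl -[leLHS]add0r lerD//; first by rewrite !mulr_ge0// invr_ge0 ltW.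
  by rewrite [leRHS]mulrAC ler_wpM2r ?invr_ge0 ?(ltW eta0).
- by rewrite /f g0 mulrAC divff// mul1r subrr.
- by rewrite /h g1 mulrAC divff// mul1r subrr.
split.
- by move/eqP: ft; rewrite subr_eq0 => /eqP <-; rewrite mulrC divfK.
- by move/eqP: ht; rewrite subr_eq0 => /eqP <-; rewrite mulrC divfK.
Qed.

(** * Vertical lines as smooth submanifolds *)

Lemma Ck_on_cst (R : realType) (k : nat) (V : set 'rV[R]_3) (c : R) :
  Ck_on k V (fun=> c).
Proof.
elim: k c => [|k IHk] c; (split=> [x _|//]; first exact: cst_continuous).
move=> i; split=> [x _|]; first exact: derivable_cst.
by under eq_fun do rewrite derive_cst; exact: IHk.
Qed.

(** The first partial derivatives are constant, so a case analysis on [k] suffices. Translated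
    coordinates are the only components that the slice chart and its inverse have. *)
Lemma Ck_on_coord (R : realType) (k : nat) (V : set 'rV[R]_3) (j : 'I_3)
    (c : R) : Ck_on k V (fun x => x 0 j + c).
Proof.
have coordE (x v : 'rV[R]_3) : is_derive x v (fun x => x 0 j + c) (v 0 j).
  have dj := is_derive_coord j (is_derive_id x v).
  by apply: is_derive_eq (is_deriveD dj (is_derive_cst c x v)) _; rewrite addr0.
case: k => [|k]; split=> [x _|] //=.
- by apply: continuousD; [exact: coord_continuous|exact: cst_continuous].
- by apply: continuousD; [exact: coord_continuous|exact: cst_continuous].
- move=> i; split=> [x _|]; first by have [] := coordE x (delta_mx 0 i).
  rewrite (_ : (fun _ => _) = fun=> (delta_mx 0 i : 'rV[R]_3) 0 j).
    exact: Ck_on_cst.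
  by apply/funext => x; have [_ ->] := coordE x (delta_mx 0 i).
Qed.

Lemma ord3_ind (P : 'I_3 -> Prop) : P 0 -> P 1 -> P 2 -> forall i, P i.
Proof.
move=> P0 P1 P2 [[|[|[|//]]] i3].
- by rewrite (_ : Ordinal i3 = 0)//; apply: val_inj.
- by rewrite (_ : Ordinal i3 = 1)//; apply: val_inj.
- by rewrite (_ : Ordinal i3 = 2)//; apply: val_inj.
Qed.

Lemma vertical_line_submanifold (R : realType) (c d : R) :
  smooth_submanifold (vertical_line c d).
Proof.
(* A single global chart. With [d = 1] the slice is cut out by the coordinates of index 1 and 2, so
   x_3 moves to index 0 and the offsets from the line take the other two places. *)
exists 1%N => // p _; exists setT, setT,
  (fun x => \row_(i < 3) [:: x 0 2; x 0 0 - c; x 0 1 - d]`_i),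
  (fun x => \row_(i < 3) [:: x 0 1 + c; x 0 2 + d; x 0 0]`_i).
split; [by split => //; exact: openT|split; [split|]].
- move=> k; apply: ord3_ind; under eq_fun do rewrite mxE /=.
  + by under eq_fun do rewrite -[_ 0 2]addr0; exact: Ck_on_coord.
  + exact: Ck_on_coord.
  + exact: Ck_on_coord.
- move=> k; apply: ord3_ind; under eq_fun do rewrite mxE /=.
  + exact: Ck_on_coord.
  + exact: Ck_on_coord.
  + by under eq_fun do rewrite -[_ 0 0]addr0; exact: Ck_on_coord.
- move=> x _; split=> //; apply/rowP; apply: ord3_ind;
    by rewrite !mxE /= ?mxE /= ?subrK.
- move=> x _; split=> //; apply/rowP; apply: ord3_ind;
    by rewrite !mxE /= ?mxE /= ?addrK.
- move=> x _; split=> [[xc xd]|Phi0].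
  + by apply: ord3_ind => // _; rewrite mxE /= (xc, xd) subrr.
  + by split; apply/eqP; rewrite -subr_eq0; apply/eqP;
      [have := Phi0 1 isT|have := Phi0 2 isT]; rewrite mxE.
Qed.

(** * Convergence to the switching set and sliding points *)

Lemma euclid_dist_vertical_line (R : realType) (x : 'rV[R]_3) (c d : R) :
  exists2 y, vertical_line c d y &
    euclid_dist x y <= `|x 0 0 - c| + `|x 0 1 - d|.
Proof.
(* The orthogonal projection of [x] onto the line; the Euclidean norm of the offset is then at most
   its l^1 norm. *)
exists (\row_(i < 3) [:: c; d; x 0 2]`_i); first by split; rewrite mxE.
rewrite /euclid_dist 3!big_ord_recl big_ord0 !mxE /=.
rewrite -[leRHS]ger0_norm ?addr_ge0// -sqrtr_sqr ler_sqrt ?sqr_ge0//.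
rewrite (_ : lift ord0 (lift ord0 ord0) = 2); last exact: val_inj.
rewrite (_ : lift ord0 ord0 = 1); last exact: val_inj.
rewrite subrr [leRHS]sqrrD !real_normK ?num_real// expr0n /= !addr0.
by rewrite lerD2r lerDl mulrn_wge0// mulr_ge0.
Qed.

(** The [0] adjoined to the supremum in [excess] gives the lower bound even for empty [A]. Both
    bounds feed the squeeze argument for convergence. *)
Lemma excess_bounds (R : realType) (A B : set 'rV[R]_3) (r : R) :
  0 <= r -> (forall x, A x -> exists2 y, B y & euclid_dist x y <= r) ->
  (0 <= excess A B <= r%:E)%E.
Proof.
move=> r_ge0 AB; rewrite ereal_sup_ubound/=; last by left.
apply: ge_ereal_sup => _ [->|[x Ax <-]]; first by rewrite lee_fin.
have [y By xy] := AB x Ax.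
by apply: ge_ereal_inf; exists (euclid_dist x y)%:E; [exists y|rewrite lee_fin].
Qed.

Lemma sliding_point_of_common_zero (R : realType) (phi : R -> R)
    (a b : bool * bool -> R) (y0 y1 : R) :
  transition_function phi ->
  blend a (phi y0) (phi y1) = 0 -> blend b (phi y0) (phi y1) = 0 ->
  forall z, Sigma00 R z -> sliding_point phi (constant_fields a b) z.
Proof.
move=> hphi a0 b0 z Sz; split=> //.
exists setT, (fun eps eta => vertical_line (eps * y0) (eta * y1)).
split=> //; first exact: openT.
  move=> eps eta eps0 eta0; split=> //; first exact: vertical_line_submanifold.
  exact: vertical_line_invariant.
(* The l^1 distance between the line and [Sigma00]. It bounds both excesses uniformly along the
   lines, hence on every [K], and tends to 0 however the two parameters do. *)
move=> K _ _; pose r (e : R * R) := e.1 * `|y0| + e.2 * `|y1|.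
have near_pos : \forall e \near filter_prod (0 : R)^'+ (0 : R)^'+,
    0 < e.1 /\ 0 < e.2.
  by exists ([set t | 0 < t], [set t | 0 < t]);
    [split; exact: nbhs_right_gt|].
have r_cvg : (r e)%:E @[e --> filter_prod (0 : R)^'+ (0 : R)^'+] --> 0%E.
  apply: cvg_EFin; first by near=> e.
  have right0 : (0 : R)^'+ --> (0 : R) by exact: cvg_within.
  have cvg1 : e.1 @[e --> filter_prod (0 : R)^'+ (0 : R)^'+] --> (0 : R).
    exact: cvg_trans cvg_fst right0.
  have cvg2 : e.2 @[e --> filter_prod (0 : R)^'+ (0 : R)^'+] --> (0 : R).
    exact: cvg_trans cvg_snd right0.
  have := cvgD (cvgM cvg1 (cvg_cst `|y0|)) (cvgM cvg2 (cvg_cst `|y1|)).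
  by rewrite !mul0r addr0; apply.
(* Stated for a general target line so as to serve both directions: [c = d = 0] gives [Sigma00], and
   [c = e.1 * y0], [d = e.2 * y1] gives the invariant line. *)
have r_bound (e : R * R) (x : 'rV[R]_3) (c d : R) : 0 < e.1 -> 0 < e.2 ->
    `|x 0 0 - c| = `|e.1 * y0| -> `|x 0 1 - d| = `|e.2 * y1| ->
    exists2 y, vertical_line c d y & euclid_dist x y <= r e.
  move=> e1 e2 xc xd; have [y cdy] := euclid_dist_vertical_line x c d.
  by rewrite xc xd !normrM (gtr0_norm e1) (gtr0_norm e2) => xy; exists y.
have r_ge0 (e : R * R) : 0 < e.1 -> 0 < e.2 -> 0 <= r e.
  by move=> e1 e2; rewrite addr_ge0// mulr_ge0// ltW.
split; apply: (squeeze_cvge _ (cvg_cst 0%E) r_cvg);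
  apply: filterS near_pos => e [e1 e2]; apply: excess_bounds; rewrite ?r_ge0//.
- by move=> x [[x0 x1] _]; apply: r_bound; rewrite ?x0 ?x1 ?subr0.
- by move=> x [[x0 x1] _]; apply: r_bound; rewrite ?x0 ?x1 ?sub0r ?normrN.
Unshelve. all: by end_near.
Qed.

Lemma equilibrium_common_zero (R : realType) (phi : R -> R)
    (a b : bool * bool -> R) (eps eta : R) (p : 'rV[R]_2) :
  0 < eps -> 0 < eta -> equilibria (x1x2_system phi a b eps eta) p ->
  blend a (phi (p 0 0)) (phi (p 0 1)) = 0 /\
  blend b (phi (p 0 0)) (phi (p 0 1)) = 0.
Proof.
move=> eps0 eta0 /rowP p0; split; apply/eqP.
- have /eqP := p0 0; rewrite !mxE /= mulf_eq0 invr_eq0 mulf_eq0 pnatr_eq0.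
  by rewrite (gt_eqF eps0).
- have /eqP := p0 1; rewrite !mxE /= mulf_eq0 invr_eq0 mulf_eq0 pnatr_eq0.
  by rewrite (gt_eqF eta0).
Qed.

Theorem theorem4p1 (R : realType) (phi : R -> R) (a b : bool * bool -> R)
  (hphi : transition_function phi)
  (hloc : forall eps eta : R, 0 < eps -> 0 < eta ->
     forall x, equilibria (x1x2_system phi a b eps eta) x ->
       (-1 < x 0 0 < 1) /\ (-1 < x 0 1 < 1)) :
  ((exists p q : 'rV[R]_2, p <> q /\
      forall eps eta : R, 0 < eps -> 0 < eta ->
        equilibria (x1x2_system phi a b eps eta) = [set p; q]) ->
   forall z, Sigma00 R z -> sliding_point phi (constant_fields a b) z)
  /\
  ((exists p : 'rV[R]_2,
      (forall eps eta : R, 0 < eps -> 0 < eta ->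
        equilibria (x1x2_system phi a b eps eta) = [set p]) /\
      (exists2 delta : R, 0 < delta &
        forall eps eta : R, 0 < eps < delta -> 0 < eta < delta ->
          asymptotically_stable (x1x2_system phi a b eps eta) p \/
          asymptotically_unstable (x1x2_system phi a b eps eta) p)) ->
   forall z, Sigma00 R z -> sliding_point phi (constant_fields a b) z).
Proof.
(* The parameters 1, 1 are an arbitrary positive choice: the resulting [blend] equations no longer
   mention them, and in both cases [p] supplies the lines for all [eps], [eta]. *)
have slides (p : 'rV[R]_2) : equilibria (x1x2_system phi a b 1 1) p ->
    forall z, Sigma00 R z -> sliding_point phi (constant_fields a b) z.
  move=> /(equilibrium_common_zero ltr01 ltr01)[a0 b0].
  exact: sliding_point_of_common_zero hphi a0 b0.
split=> [[p [q [_ eqE]]]|[p [eqE _]]]; apply: (slides p);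
  by rewrite eqE ?ltr01//; left.
Qed.
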